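(* Let $G$ be either the Pappus graph $\mathcal P$ or the Desargues graph $\mathcal D$. Then $G$ is a strongly coherent $\{C_6\}_{P_3}$-ultrahomogeneous graph, where $C_6$ is the cycle on $6$ vertices and $P_3$ is the path on $3$ vertices (regarded as a subgraph of $C_6$).
   Context: All graphs are finite and simple. **The graphs.** The Pappus graph $\mathcal P$ is the cubic graph on vertex set $\mathbb Z_{18}$ obtained from the $18$-cycle $(0,1,\ldots,17)$ by adding the edges $\{1+6x,6+6x\}$, $\{2+6x,9+6x\}$, $\{4+6x,11+6x\}$ for $x\in\{0,1,2\}$ (mod $18$). The Desargues graph $\mathcal D$ is the cubic graph obtained from the $20$-cycle $(0,1,\ldots,19)$, whose vertices $4x,4x+1,4x+2,4x+3$ are renamed $x_0,x_1,x_2,x_3$ respectively ($x\in\mathbb Z_5$), by adding the edges $\{x_3,(x+2)_0\}$ and $\{x_1,(x+2)_2\}$ for $x\in\mathbb Z_5$ (mod $5$). **Definitions.** A copy of a graph $H$ in $G$ is a subgraph of $G$ isomorphic to $H$. For a graph $H$, a graph $G$ is $H$-ultrahomogeneous ($H$-UH) if every isomorphism between two induced copies of $H$ in $G$ extends to an automorphism of $G$. Let $M$ be an induced subgraph of $H$ and let $G$ be both $M$-UH and $H$-UH. Write $H_0\cap H_1=M_0$ to mean $V(H_0)\cap V(H_1)=V(M_0)$ and $E(H_0)\cap E(H_1)=E(M_0)$. $G$ is an $\{H\}_M$-UH graph if, for each copy $H_0$ of $H$ induced in $G$ and each copy $M_0$ of $M$ contained in $H_0$, there exists exactly one copy $H_1\neq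 H_0$ of $H$ induced in $G$ such that $H_0\cap H_1=M_0$. An $\{H\}_M$-UH graph $G$ is $\ell$-coherent $\{H\}_M$-UH if, given a copy $H_0$ of $H$ induced in $G$ and containing a copy $M_0$ of $M$, there exist exactly $\ell$ copies $H_i\neq H_0$ of $H$ induced in $G$ with $H_i\cap H_0\supseteq M_0$ ($i=1,\ldots,\ell$), and (with suitable labelling) $H_1\cap H_0=M_0$. For $|V(H)|>3$ and $M$ a subgraph of $H$, $G$ is strongly coherent $\{H\}_M$-UH if there is a descending sequence of connected subgraphs $M=M_1,M_2,\ldots,M_t\cong K_2$ such that (a) $M_{i+1}$ is obtained from $M_i$ by deleting a vertex, for $i=1,\ldots,t-1$, and (b) $G$ is a $(2^i-1)$-coherent $\{H\}_{M_i}$-UH graph for $i=1,\ldots,t$. *)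

(* Defs.v *)
From HB Require Import structures.
From mathcomp Require Import all_boot all_order all_algebra.

Set Implicit Arguments.
Unset Strict Implicit.
Unset Printing Implicit Defensive.

Local Open Scope nat_scope.

Record sgraph := SGraph {
  vertex :> finType;
  adj : rel vertex;
  adj_sym : symmetric adj;
  adj_irr : irreflexive adj }.

Definition edges (G : sgraph) : {set {set G}} :=
  [set e | [exists u : G, exists v : G, adj u v && (e == [set u; v])]].

(* A subgraph is a vertex set together with an edge set; it is wrapped as a
   subtype of a finite type so that subgraphs are equal exactly when both
   their vertex sets and their edge sets are, and can be counted. *)
Record subgraph (G : sgraph) := Subgraph {
  sg_pair : {set G} * {set {set G}};
  sg_wf : (sg_pair.2 \subset edges G) && (cover sg_pair.2 \subset sg_pair.1) }.

HB.instance Definition _ (G : sgraph) := [isSub for @sg_pair G].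
HB.instance Definition _ (G : sgraph) := [Finite of subgraph G by <:].

Definition sgV (G : sgraph) (K : subgraph G) : {set G} := (sg_pair K).1.
Definition sgE (G : sgraph) (K : subgraph G) : {set {set G}} := (sg_pair K).2.

Section SubgraphAsGraph.
Variables (G : sgraph) (K : subgraph G).

Definition sg_adj : rel {x : G | x \in sgV K} :=
  fun u v => [set val u; val v] \in sgE K.

Lemma sg_adj_sym : symmetric sg_adj.
Proof. by move=> u v; rewrite /sg_adj setUC. Qed.

Lemma sg_adj_irr : irreflexive sg_adj.
Proof.
move=> u; apply/negP => uE.
have /andP[/subsetP sE _] := sg_wf K.
have := sE _ uE; rewrite inE => /existsP[x /existsP[y /andP[xy /eqP e]]].
have ex : x = val u by apply/set1P; rewrite -(setUid [set val u]) e set21.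
have ey : y = val u by apply/set1P; rewrite -(setUid [set val u]) e set22.
by rewrite ex ey adj_irr in xy.
Qed.

Definition sgraph_of : sgraph := SGraph sg_adj_sym sg_adj_irr.
End SubgraphAsGraph.

Coercion sgraph_of : subgraph >-> sgraph.

Definition is_iso (G H : sgraph) (f : G -> H) : Prop :=
  bijective f /\ forall x y : G, adj (f x) (f y) = adj x y.

Definition isomorphic (G H : sgraph) : Prop := exists f : G -> H, is_iso f.

Definition connected (G : sgraph) : Prop :=
  0 < #|G| /\ forall x y : G, connect (@adj G) x y.

Definition induced (G : sgraph) (K : subgraph G) : Prop :=
  forall x y : G, x \in sgV K -> y \in sgV K -> adj x y ->
    [set x; y] \in sgE K.

Definition copy_of (H G : sgraph) (K : subgraph G) : Prop := isomorphic K H.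

Definition induced_copy_of (H G : sgraph) (K : subgraph G) : Prop :=
  copy_of H K /\ induced K.

Definition contained (G : sgraph) (A B : subgraph G) : Prop :=
  sgV A \subset sgV B /\ sgE A \subset sgE B.

Definition meet_eq (G : sgraph) (A B K : subgraph G) : Prop :=
  sgV A :&: sgV B = sgV K /\ sgE A :&: sgE B = sgE K.

Definition meet_contains (G : sgraph) (A B K : subgraph G) : Prop :=
  sgV K \subset sgV A :&: sgV B /\ sgE K \subset sgE A :&: sgE B.

Definition ultrahomogeneous (H G : sgraph) : Prop :=
  forall A B : subgraph G, induced_copy_of H A -> induced_copy_of H B ->
  forall f : A -> B, is_iso f ->
  exists2 phi : G -> G, is_iso phi & forall x : A, phi (val x) = val (f x).

(* {H}_M-ultrahomogeneity presupposes that M is induced in H and that G is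
   both M-UH and H-UH; these are made part of the notion. *)
Definition HM_UH (H : sgraph) (M : subgraph H) (G : sgraph) : Prop :=
  [/\ induced M,
      ultrahomogeneous M G,
      ultrahomogeneous H G &
      forall H0 M0 : subgraph G,
        induced_copy_of H H0 -> copy_of M M0 -> contained M0 H0 ->
        exists! H1 : subgraph G,
          [/\ H1 <> H0, induced_copy_of H H1 & meet_eq H0 H1 M0]].

Definition coherent_UH (l : nat) (H : sgraph) (M : subgraph H) (G : sgraph) :
    Prop :=
  HM_UH M G /\
  forall H0 M0 : subgraph G,
    induced_copy_of H H0 -> copy_of M M0 -> contained M0 H0 ->
    exists S : {set subgraph G},
      [/\ #|S| = l,
          forall K : subgraph G, K \in S <->
            [/\ K <> H0, induced_copy_of H K & meet_contains K H0 M0] &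
          exists2 H1 : subgraph G, H1 \in S & meet_eq H1 H0 M0].

Definition vertex_deletion (G : sgraph) (A B : subgraph G) : Prop :=
  exists2 v : G, v \in sgV A &
    sgV B = sgV A :\ v /\ sgE B = [set e in sgE A | v \notin e].

Section SimpleGraphOfRel.
Variables (T : finType) (r : rel T).

Definition simple_rel : rel T := fun u v => (u != v) && (r u v || r v u).

Lemma simple_rel_sym : symmetric simple_rel.
Proof. by move=> u v; rewrite /simple_rel eq_sym orbC. Qed.

Lemma simple_rel_irr : irreflexive simple_rel.
Proof. by move=> u; rewrite /simple_rel eqxx. Qed.

Definition graph_of_rel : sgraph := SGraph simple_rel_sym simple_rel_irr.
End SimpleGraphOfRel.

Definition complete_graph (n : nat) : sgraph :=
  graph_of_rel (fun _ _ : 'I_n => true).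

Definition path_graph (n : nat) : sgraph :=
  graph_of_rel (fun u v : 'I_n => v == u.+1 :> nat).

(* The n-cycle for n >= 3. *)
Definition cycle_graph (n : nat) : sgraph :=
  graph_of_rel (fun u v : 'I_n => v == u.+1 %% n :> nat).

(* The sequence M_1, ..., M_t is indexed from 1; the values of Ms outside
   1..t are irrelevant. *)
Definition strongly_coherent_UH (H : sgraph) (M : subgraph H) (G : sgraph) :
    Prop :=
  3 < #|H| /\
  exists (t : nat) (Ms : nat -> subgraph H),
    [/\ 1 <= t /\ Ms 1 = M,
        isomorphic (Ms t) (complete_graph 2),
        forall i, 1 <= i <= t -> connected (Ms i),
        forall i, 1 <= i < t -> vertex_deletion (Ms i) (Ms i.+1) &
        forall i, 1 <= i <= t -> coherent_UH (2 ^ i - 1) (Ms i) G].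

Definition Pappus_arc : rel 'Z_18 := fun u v =>
  (v == u + 1)%R ||
  [exists x : 'I_3,
    (u, v) \in [:: ((1 + 6 * x)%N%:R, (6 + 6 * x)%N%:R);
                   ((2 + 6 * x)%N%:R, (9 + 6 * x)%N%:R);
                   ((4 + 6 * x)%N%:R, (11 + 6 * x)%N%:R)]%R].

Definition Pappus : sgraph := graph_of_rel Pappus_arc.

(* The vertex x_i, i.e. 4x+i with x represented in {0,...,4}. *)
Definition Dvertex (x : 'Z_5) (i : nat) : 'Z_20 := (4 * x + i)%N%:R%R.

Definition Desargues_arc : rel 'Z_20 := fun u v =>
  (v == u + 1)%R ||
  [exists x : 'Z_5,
    (u, v) \in [:: (Dvertex x 3, Dvertex (x + 2)%R 0);
                   (Dvertex x 1, Dvertex (x + 2)%R 2)]].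

Definition Desargues : sgraph := graph_of_rel Desargues_arc.

(* Main.v *)
(** A labelled copy of [H] in [G] is an embedding [H -> G]; its image is the
copy. For [k = 2, 3], an embedding of [P_k] in [C_6] extends to a unique
symmetry of [C_6], so the hexagons containing a given path [P_k] of a labelled
hexagon [h] correspond to the labelled hexagons that agree with [h] on the
first [k] vertices. All the coherence conditions thus follow from four facts
about [G]: the automorphisms act transitively on labelled hexagons; every edge
and every 2-arc lies in a hexagon; hexagons have no chords; and each labelled
hexagon shares its first [k] vertices with exactly [2 ^ (4 - k)] labelled
hexagons, exactly one of which meets it in nothing else. For the Pappus and
Desargues graphs these are checked by enumerating the 216, respectively 240,
labelled hexagons and by showing that they form a single orbit under the group
generated by two explicit automorphisms. *)

Require Import Defs.
From mathcomp Require Import all_boot all_order all_algebra.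
From mathcomp Require Import zify.

Set Implicit Arguments.
Unset Strict Implicit.
Unset Printing Implicit Defensive.

Local Notation C6 := (cycle_graph 6).

(** * Embeddings and their images *)

Lemma set2_inj (T : finType) (a b c d : T) :
  [set a; b] = [set c; d] -> (a = c /\ b = d) \/ (a = d /\ b = c).
Proof.
move=> e.
have := set21 a b; rewrite e => /set2P ha.
have := set22 a b; rewrite e => /set2P hb.
have := set21 c d; rewrite -e => /set2P hc.
have := set22 c d; rewrite -e => /set2P hd.
by case: ha hb hc hd => ha [hb|hb] [hc|hc] [hd|hd]; subst; auto.
Qed.

Lemma connect_homo (T U : finType) (e : rel T) (e' : rel U) (f : T -> U) :
  {homo f : x y / e x y >-> e' x y} ->
  {homo f : x y / connect e x y >-> connect e' x y}.
Proof.
move=> fA x y /connectP[p pp ->]; apply/connectP; exists (map f p).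
  exact: homo_path pp.
by rewrite last_map.
Qed.

Lemma adjC (G : sgraph) (x y : G) : adj x y = adj y x.
Proof. exact: adj_sym. Qed.

Lemma iso_sym (G H : sgraph) (f : G -> H) : is_iso f ->
  exists2 g : H -> G, is_iso g & cancel f g /\ cancel g f.
Proof.
case=> -[g fK gK] fA; exists g; last by [].
by split=> [|x y]; [exists f | rewrite -fA !gK].
Qed.

Lemma iso_comp (G H K : sgraph) (g : H -> K) (f : G -> H) :
  is_iso g -> is_iso f -> is_iso (g \o f).
Proof.
by move=> [bg gA] [bf fA]; split=> [|x y]; [exact: bij_comp | rewrite /= gA].
Qed.

Lemma isomorphic_sym (G H : sgraph) : isomorphic G H -> isomorphic H G.
Proof. by case=> f /iso_sym[g gi _]; exists g. Qed.

Lemma isomorphic_trans (G H K : sgraph) :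
  isomorphic G H -> isomorphic H K -> isomorphic G K.
Proof. by move=> [f fi] [g gi]; exists (g \o f); exact: iso_comp. Qed.

Lemma connected_iso (G H : sgraph) :
  isomorphic G H -> connected G -> connected H.
Proof.
case=> f [[g fK gK] fA] [/card_gt0P[x0 _] cG]; split.
  by apply/card_gt0P; exists (f x0).
move=> x y; rewrite -[x]gK -[y]gK.
by apply: connect_homo (cG (g x) (g y)) => u v; rewrite fA.
Qed.

Definition emb (H G : sgraph) (f : H -> G) : bool :=
  injectiveb f && [forall x, forall y, adj x y ==> adj (f x) (f y)].

Lemma embP (H G : sgraph) (f : H -> G) :
  reflect (injective f /\ {homo f : x y / adj x y}) (emb f).
Proof.
apply: (iffP andP) => -[fI fA]; split; try exact/injectiveP.
- by move=> x y xy; move/forallP: fA => /(_ x)/forallP/(_ y)/implyP; apply.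
- by apply/forallP=> x; apply/forallP=> y; apply/implyP; apply: fA.
Qed.

Lemma eq_emb (H G : sgraph) (f g : H -> G) : f =1 g -> emb f -> emb g.
Proof.
move=> fg /embP[fI fA]; apply/embP; split=> [x y|x y xy].
  by rewrite -!fg; apply: fI.
by rewrite -!fg fA.
Qed.

Lemma emb_comp (K H G : sgraph) (g : H -> G) (f : K -> H) :
  emb g -> emb f -> emb (g \o f).
Proof.
move=> /embP[gI gA] /embP[fI fA]; apply/embP; split; first exact: inj_comp.
by move=> x y xy; apply/gA/fA.
Qed.

Lemma iso_emb (H G : sgraph) (f : H -> G) : is_iso f -> emb f.
Proof.
by move=> [bf fA]; apply/embP; split=> [|x y]; [exact: bij_inj | rewrite fA].
Qed.

Lemma subgraph_eq (G : sgraph) (A B : subgraph G) :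
  sgV A = sgV B -> sgE A = sgE B -> A = B.
Proof.
move=> eV eE; apply: val_inj => /=; move: eV eE; rewrite /sgV /sgE.
by case: (sg_pair A) (sg_pair B) => [? ?] [? ?] /= -> ->.
Qed.

Lemma mem_edges (G : sgraph) (x y : G) : ([set x; y] \in edges G) = adj x y.
Proof.
apply/idP/idP=> [|xy]; last first.
  by rewrite inE; apply/existsP; exists x; apply/existsP; exists y;
    rewrite xy /=.
rewrite inE => /existsP[u /existsP[v /andP[uv /eqP/set2_inj[] [-> ->]]]] //.
by rewrite adjC.
Qed.

Lemma sgE_edge (G : sgraph) (A : subgraph G) (e : {set G}) :
  e \in sgE A -> exists x y, [/\ e = [set x; y], adj x y,
    x \in sgV A & y \in sgV A].
Proof.
move=> eA; have /andP[/subsetP sE /subsetP sV] := sg_wf A.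
have := sE _ eA; rewrite inE => /existsP[u /existsP[v /andP[uv /eqP ee]]].
exists u, v; split=> //; apply: sV; apply/bigcupP; exists e => //;
  by rewrite ee !inE eqxx ?orbT.
Qed.

(* Intersecting with [edges G] makes the image total in [f]; nothing is lost
   when [f] is an embedding. *)
Section Image.
Variables (H G : sgraph) (f : H -> G).

Definition im_pair : {set G} * {set {set G}} :=
  (f @: setT, [set f @: (e : {set H}) | e in edges H] :&: edges G).

Lemma im_wf : (im_pair.2 \subset edges G) &&
  (cover im_pair.2 \subset im_pair.1).
Proof.
rewrite subsetIr /=; apply/bigcupsP=> e; rewrite inE => /andP[/imsetP[e' _
  ->] _].
by apply: imsetS; apply: subsetT.
Qed.

Definition im : subgraph G := Subgraph im_wf.
End Image.

Lemma eq_im (H G : sgraph) (f g : H -> G) : f =1 g -> im f = im g.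
Proof.
move=> fg; apply: subgraph_eq; first exact: eq_imset.
congr (_ :&: _); apply: eq_imset => e; exact: eq_imset.
Qed.

Lemma im_VP (H G : sgraph) (f : H -> G) x :
  reflect (exists a, x = f a) (x \in sgV (im f)).
Proof.
by apply: (iffP imsetP) => [[a _ ->]|[a ->]]; exists a.
Qed.

Lemma im_EP (H G : sgraph) (f : H -> G) e : emb f ->
  reflect (exists a b, adj a b /\ e = [set f a; f b]) (e \in sgE (im f)).
Proof.
move=> /embP[fI fA]; apply: (iffP idP) => [|[a [b [ab ->]]]].
  rewrite inE => /andP[/imsetP[e']]; rewrite inE.
  case/existsP=> a /existsP[b /andP[ab /eqP->]] -> _.
  by exists a, b; rewrite imsetU !imset_set1.
rewrite inE mem_edges fA // andbT; apply/imsetP; exists [set a; b].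
  by rewrite mem_edges.
by rewrite imsetU !imset_set1.
Qed.

Lemma im_E2 (H G : sgraph) (f : H -> G) a b : emb f ->
  ([set f a; f b] \in sgE (im f)) = adj a b.
Proof.
move=> fe; have /embP[fI fA] := fe; apply/im_EP/idP => // [|ab];
  last by exists a, b.
by case=> c [d [cd /set2_inj[] [/fI-> /fI->]]]; rewrite // adjC.
Qed.

Lemma im_comp_iso (K H G : sgraph) (h : H -> G) (s : K -> H) :
  emb h -> is_iso s -> im (h \o s) = im h.
Proof.
move=> he si; have he' := emb_comp he (iso_emb si).
have [t [_ tA] [sK tK]] := iso_sym si; apply: subgraph_eq.
  apply/setP=> x; apply/im_VP/im_VP=> [[a ->]|[a ->]]; first by exists (s a).
  by exists (t a); rewrite /= tK.
apply/setP=> e; apply/im_EP/im_EP=> // -[a [b [ab ->]]].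
  by exists (s a), (s b); rewrite (proj2 si).
by exists (t a), (t b); rewrite /= !tK tA.
Qed.

Lemma copy_im (H G : sgraph) (f : H -> G) : emb f -> copy_of H (im f).
Proof.
move=> fe; apply: isomorphic_sym.
have fV a : f a \in sgV (im f) by apply/im_VP; exists a.
exists (fun a : H => Sub (f a) (fV a) : im f); split.
  apply: inj_card_bij => [a b /(congr1 val)|] /=.
    by rewrite ?SubK; case/embP: fe => fI _; apply: fI.
  by rewrite card_sig -cardsT; apply: leq_imset_card.
by move=> a b; rewrite /= /sg_adj /= im_E2.
Qed.

(** Together with [copy_im], this trades unlabelled copies for embeddings, with which the later
    arguments work. *)
Lemma copyP (H G : sgraph) (K : subgraph G) : copy_of H K ->
  exists2 f : H -> G, emb f & K = im f.
Proof.
case/isomorphic_sym=> g [[g' gK g'K] gA].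
have fe : emb (fun a => val (g a)).
  apply/embP; split=> [a b /val_inj/(can_inj gK)//|a b].
  rewrite -gA => /sgE_edge[x [y [/set2_inj[] [-> ->] //]]]; by rewrite adjC.
exists (fun a => val (g a)) => //; apply: subgraph_eq.
  apply/setP=> x; apply/idP/im_VP=> [xK|[a ->]]; last exact: (valP (g a)).
  by exists (g' (Sub x xK)); rewrite g'K SubK.
apply/setP=> e; apply/idP/im_EP => // [eK|[a [b [ab ->]]]]; last first.
  by rewrite -gA in ab.
have [x [y [ee _ xK yK]]] := sgE_edge eK.
exists (g' (Sub x xK)), (g' (Sub y yK)); rewrite !g'K !SubK; split=> //.
by rewrite -gA !g'K /= /sg_adj !SubK -ee.
Qed.

Lemma copyPiso (P H G : sgraph) (K : subgraph G) :
  isomorphic P H -> copy_of H K -> exists2 f : P -> G, emb f & K = im f.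
Proof. by move=> PH KH; apply/copyP/(isomorphic_trans KH)/isomorphic_sym. Qed.

(** Containment of vertex sets supplies preimages under [h]; containment of edge sets makes the
    resulting map preserve adjacency, since the edges of [im h] come from edges of [H] only. *)
Lemma contained_factor (K H G : sgraph) (m : K -> G) (h : H -> G) :
  emb m -> emb h -> contained (im m) (im h) ->
  exists2 j : K -> H, emb j & m =1 h \o j.
Proof.
move=> me he [/subsetP sV /subsetP sE].
have [j jP] : exists j : K -> H, forall a, m a = h (j a).
  apply: (@fin_all_exists _ (fun=> H) (fun a b => m a = h b)) => a.
  by apply/im_VP/sV/im_VP; exists a.
exists j => //; have /embP[mI mA] := me; apply/embP; split=> [a b ab|a b ab].
  by apply: mI; rewrite !jP ab.
by rewrite -(im_E2 _ _ he) -!jP; apply: sE; rewrite im_E2.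
Qed.

Lemma contained_comp (K H G : sgraph) (h : H -> G) (j : K -> H) :
  emb h -> emb j -> contained (im (h \o j)) (im h).
Proof.
move=> he je; split; apply/subsetP.
  by move=> _ /im_VP[a ->]; apply/im_VP; exists (j a).
move=> _ /im_EP[|a [b [ab ->]]]; first exact: emb_comp.
by rewrite /= im_E2 //; case/embP: je => _; apply.
Qed.

(** A labelled, stronger form of ultrahomogeneity: the images of [f] and [g] may fail to be
    induced. *)
Definition homogeneous (H G : sgraph) : Prop :=
  forall f g : H -> G, emb f -> emb g ->
  exists2 phi : G -> G, is_iso phi & forall x, phi (f x) = g x.

(** A labelling [s] of the copy [A] by [P] turns an isomorphism from [A] to [B] into two embeddings
    of [P] in [G]. *)
Lemma homogeneous_UH (P H G : sgraph) :
  isomorphic P H -> homogeneous P G -> ultrahomogeneous H G.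
Proof.
move=> PH hom A B [cA _] _ f fi.
have valE (C : subgraph G) : emb (fun x : C => val x).
  apply/embP; split=> [|x y]; first exact: val_inj.
  by case/sgE_edge=> u [v [/set2_inj[] [-> ->] //]]; rewrite adjC.
have [s si] := isomorphic_trans PH (isomorphic_sym cA).
have [t _ [_ tK]] := iso_sym si.
have [|| phi phii phiE] := hom (fun x => val (s x)) (fun x => val (f (s x))).
- exact: emb_comp (valE A) (iso_emb si).
- exact: emb_comp (emb_comp (valE B) (iso_emb fi)) (iso_emb si).
by exists phi => // x; rewrite -[x]tK phiE.
Qed.

(** Used to pass homogeneity from the hexagon to its subpaths: two embeddings of [K] are matched by
    matching their extensions. *)
Lemma homogeneous_sub (K H G : sgraph) (i : K -> H) :
  (forall m : K -> G, emb m -> exists2 h : H -> G, emb h & m =1 h \o i) ->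
  homogeneous H G -> homogeneous K G.
Proof.
move=> ext hom f g /ext[f' fe fE] /ext[g' ge gE].
have [phi phii phiE] := hom _ _ fe ge; exists phi => // x.
by rewrite fE gE /= phiE.
Qed.

(** * Symmetries of the hexagon *)

Lemma all_ordP n (P : nat -> bool) : all P (iota 0 n) -> forall i : 'I_n, P i.
Proof. by move=> /allP allP i; apply: allP; rewrite mem_iota ltn_ord. Qed.

Lemma all2_ordP m n (P : nat -> nat -> bool) :
  all (fun i => all (P i) (iota 0 n)) (iota 0 m) ->
  forall (i : 'I_m) (j : 'I_n), P i j.
Proof. by move=> /all_ordP allP i j; apply: (all_ordP (allP i)). Qed.

(** Adjacency in the hexagon is restated on [nat] so that checks over [iota 0 6] run by
    [vm_compute]. *)
Definition cyc6 (i j : nat) : bool :=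
  (i != j) && ((j == i.+1 %% 6) || (i == j.+1 %% 6)).

Lemma adj_C6 (i j : C6) : adj i j = cyc6 i j.
Proof. by []. Qed.

Definition c6 (i : nat) : C6 := inord i.

Lemma c6K (i : nat) : i < 6 -> c6 i = i :> nat.
Proof. exact: inordK. Qed.

Lemma c6_val (i : C6) : c6 i = i.
Proof. exact: inord_val. Qed.

(* The dihedral symmetry of the hexagon that maps the arc (0, 1) to (i, j). *)
Definition rot6 (i j t : nat) : nat := (i + t * (j + 6 - i)) %% 6.

Lemma rot6_iso (i j : C6) : adj i j -> is_iso (fun t : C6 => c6 (rot6 i j t)).
Proof.
have lt6 (a b c : nat) : rot6 a b c < 6 by rewrite ltn_pmod.
have chk : all (fun i => all (fun j => cyc6 i j ==>
    all (fun x => all (fun y =>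
      ((rot6 i j x == rot6 i j y) == (x == y)) &&
      (cyc6 (rot6 i j x) (rot6 i j y) == cyc6 x y)) (iota 0 6)) (iota 0 6))
    (iota 0 6)) (iota 0 6) by vm_compute.
move: (all2_ordP chk i j); rewrite adj_C6 => /implyP/[apply] {}chk.
have {chk}cij := all2_ordP chk.
split=> [|x y].
  apply: injF_bij => x y /(congr1 val); rewrite /= !c6K // => /eqP.
  by case/andP: (cij x y) => /eqP-> _ /eqP; apply: val_inj.
by rewrite !adj_C6 !c6K //; case/andP: (cij x y) => _ /eqP.
Qed.

Definition path_incl k : path_graph k -> C6 := fun a => c6 a.

Lemma adj_path k (a b : path_graph k) :
  adj a b = (a.+1 == b :> nat) || (b.+1 == a :> nat).
Proof.
rewrite /= /simple_rel -val_eqE /= ![_ == _.+1]eq_sym.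
by apply/andb_idl => /orP[] /eqP <-; rewrite neq_ltn ltnSn ?orbT.
Qed.

Lemma path_inclE k (a : path_graph k) : k < 6 -> path_incl a = a :> nat.
Proof. by move=> k6; rewrite c6K // (ltn_trans (ltn_ord a)). Qed.

Lemma adj_path_incl k (a b : path_graph k) : k < 6 ->
  adj (path_incl a) (path_incl b) = adj a b.
Proof.
move=> k6; rewrite adj_C6 adj_path !path_inclE // /cyc6.
have := ltn_ord a; have := ltn_ord b; lia.
Qed.

Lemma path_incl_emb k : k < 6 -> emb (@path_incl k).
Proof.
move=> k6; apply/embP; split=> [a b ab|a b]; last by rewrite adj_path_incl.
by apply: val_inj; rewrite /= -(path_inclE a) // ab path_inclE.
Qed.

Lemma cyc6_next (a b : C6) : adj a b -> forall c : C6,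
  adj b c -> c != a -> c = c6 (rot6 a b 2).
Proof.
have chk : all (fun i => all (fun j => cyc6 i j ==>
  all (fun c => cyc6 j c ==> (c != i) ==> (c == rot6 i j 2)) (iota 0 6))
    (iota 0 6)) (iota 0 6) by vm_compute.
move: (all2_ordP chk a b); rewrite adj_C6 => /implyP/[apply] {}chk c.
have /implyP := all_ordP chk c; rewrite -adj_C6 =>
  /[apply]/implyP/[apply]/eqP cE.
by apply: val_inj; rewrite /= c6K // -cE.
Qed.

(** The images of 0 and 1 determine a dihedral symmetry; when [k = 3], the image of 2 is forced,
    being the neighbour of the image of 1 other than that of 0. *)
Lemma C6_arc_extend k (j : path_graph k -> C6) : 1 < k <= 3 -> emb j ->
  exists2 s : C6 -> C6, is_iso s & forall a, s (path_incl a) = j a.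
Proof.
move=> /andP[k1 k3] /embP[jI jA].
pose o i (lti : i < k) : path_graph k := Ordinal lti.
have j01 : adj (j (o 0 (ltnW k1))) (j (o 1 k1)) by apply: jA; rewrite adj_path.
exists (fun t : C6 => c6 (rot6 (j (o 0 (ltnW k1))) (j (o 1 k1)) t)).
  exact: rot6_iso.
move=> a; rewrite path_inclE; last by lia.
have: a < 3 by rewrite (leq_trans (ltn_ord a)).
have eo i (lti : i < k) : (a : nat) = i -> a = o i lti by move=> ai;
  apply: val_inj.
case ai: (val a) => [|[|[|]]] // _.
- rewrite (eo 0 (ltnW k1) ai) /rot6 /= mul0n addn0 modn_small ?ltn_ord //.
  exact: c6_val.
- rewrite (eo 1 k1 ai) /rot6 /= mul1n subnKC; last first.
    by rewrite ltnW // (leq_trans (ltn_ord _)) // leq_addl.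
  rewrite modnDr modn_small ?ltn_ord //; exact: c6_val.
have k2 : 2 < k by rewrite -ai ltn_ord.
rewrite (eo 2 k2 ai); apply/esym/cyc6_next => //.
- by apply: jA; rewrite adj_path.
- by apply/eqP => /jI.
Qed.

(** Going round the hexagon from 0 and 1, each next vertex is the only neighbour of the current one
    that is not the previous one. *)
Lemma C6_rigid (j : C6 -> C6) : emb j -> j (c6 0) = c6 0 -> j (c6 1) = c6 1 ->
  forall i, j i = i.
Proof.
move=> /embP[jI jA] j0 j1.
suff jn n : n < 5 -> j (c6 n) = c6 n /\ j (c6 n.+1) = c6 n.+1.
  move=> i; rewrite -[i]c6_val; have := ltn_ord i.
  by case: (val i) => // n n5; case: (jn n n5).
elim: n => // n IH n5; have [jn jn1] := IH (ltnW n5).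
have a1 m : m < 5 -> adj (c6 m) (c6 m.+1).
  by move=> m5; rewrite adj_C6 !c6K // /cyc6; lia.
(* Both [c6 n.+2] and its image are the neighbour of [c6 n.+1] other than [c6 n]. *)
split=> //; have next := cyc6_next (a1 n (ltnW n5)).
rewrite [RHS]next; first last.
- by rewrite -val_eqE /= !c6K; lia.
- exact: a1.
apply: next; first by rewrite -jn1; apply: jA; apply: a1.
by apply/eqP; rewrite -jn => /jI/(congr1 val); rewrite /= !c6K; lia.
Qed.

(** * Coherence from hexagon counts *)

Section Hexagons.
Variable G : sgraph.

(** An embedding [h] belongs to its own set, so the size is one more than the number of other
    hexagons through the path. *)
Definition hex_ext k (h : C6 -> G) : {set {ffun C6 -> G}} :=
  [set g : {ffun C6 -> G} | emb g & [forall i : C6, (i < k) ==> (g i == h i)]].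

(** Only vertices are compared; [hex_meetP] recovers the edges from the absence of chords. *)
Definition hex_new k (h g : C6 -> G) : bool :=
  [forall i : C6, forall j : C6, (k <= i) ==> (g i != h j)].

Hypothesis hex_hom : homogeneous C6 G.
Hypothesis path_ext : forall k (m : path_graph k -> G), 1 < k <= 3 -> emb m ->
  exists2 h : C6 -> G, emb h & m =1 h \o @path_incl k.
Hypothesis hex_chordless : forall (h : C6 -> G), emb h ->
  forall x y, adj (h x) (h y) -> adj x y.
(** The path on [k] vertices has index [4 - k] in the descending sequence, so [2 ^ (4 - k)] is its
    coherence number plus one. *)
Hypothesis card_hex_ext : forall k (h : {ffun C6 -> G}), 1 < k <= 3 -> emb h ->
  #|hex_ext k h| = 2 ^ (4 - k).
Hypothesis card_hex_new : forall k (h : {ffun C6 -> G}), 1 < k <= 3 -> emb h ->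
  #|[set g in hex_ext k h | hex_new k h g]| = 1.

Lemma hex_induced (h : C6 -> G) : emb h -> induced_copy_of C6 (im h).
Proof.
move=> he; split; first exact: copy_im.
by move=> _ _ /im_VP[a ->] /im_VP[b ->] /(hex_chordless he) ab; rewrite im_E2.
Qed.

Lemma hex_extP k (h : C6 -> G) (g : {ffun C6 -> G}) : k < 6 ->
  reflect (emb g /\ h \o @path_incl k =1 g \o @path_incl k) (g \in hex_ext k h).
Proof.
move=> k6; rewrite inE; apply: (iffP andP) => -[ge gh]; split=> //.
  move=> a; apply/esym/eqP; move/forallP: gh => /(_ (path_incl a))/implyP.
  by apply; rewrite path_inclE.
apply/forallP=> i; apply/implyP=> ik.
have -> : i = path_incl (Ordinal ik : path_graph k).
  by apply: val_inj; rewrite /= path_inclE.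
by apply/eqP/esym/gh.
Qed.

Section Coherence.
Variable k : nat.
Hypothesis k13 : 1 < k <= 3.
Let k6 : k < 6. Proof. by case/andP: k13 => _ /leq_ltn_trans; apply. Qed.
Local Notation incl := (@path_incl k).

(** The path factors through [g] by an embedding into the hexagon, which extends to a symmetry [s];
    relabelling [g] by [s] makes it agree with [h] on the path. *)
Lemma hex_frame (h g : C6 -> G) : emb h -> emb g ->
  contained (im (h \o incl)) (im g) ->
  exists2 g' : {ffun C6 -> G}, g' \in hex_ext k h & im g' = im g.
Proof.
move=> he ge hg; have hie := emb_comp he (path_incl_emb k6).
have [j je jE] := contained_factor hie ge hg.
have [s si sE] := C6_arc_extend k13 je.
exists [ffun x => g (s x)].
  apply/hex_extP => //; split.
    by apply: eq_emb (emb_comp ge (iso_emb si)) => x; rewrite ffunE.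
  by move=> a; rewrite /= ffunE sE; apply: jE.
by rewrite -(im_comp_iso ge si); apply: eq_im => x; rewrite ffunE.
Qed.

(** Two labellings of one hexagon differ by a symmetry; agreement on the first [k > 1] vertices
    makes it fix 0 and 1, hence trivial. So counting labelled hexagons counts copies. *)
Lemma hex_ext_inj (h : C6 -> G) : 
  {in hex_ext k h &, injective (fun g : {ffun C6 -> G} => im g)}.
Proof.
have k1 : 1 < k by case/andP: k13.
move=> f g /(hex_extP _ _ k6)[fe hf] /(hex_extP _ _ k6)[ge hg] fg.
have [|j je jE] := contained_factor fe ge; first by rewrite fg; split.
have fgE i : i < k -> f (c6 i) = g (c6 i).
  by move=> ik; have := hf (Ordinal ik); rewrite hg /= => ->.
have j0 i : i < k -> j (c6 i) = c6 i.
  by move=> ik; case/embP: ge => gI _; apply: gI; rewrite -fgE //;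
    apply/esym/jE.
by apply/ffunP=> i; rewrite jE /= (C6_rigid je) ?j0 // ltnW.
Qed.

Lemma hex_meetP (h g : {ffun C6 -> G}) : emb h -> g \in hex_ext k h ->
  reflect (meet_eq (im h) (im g) (im (h \o incl))) (hex_new k h g).
Proof.
move=> he /(hex_extP _ _ k6)[ge hg].
have /embP[gI _] := ge; have ie := path_incl_emb k6.
apply: (iffP idP) => [new|[mV _]].
  (* A vertex common to both hexagons has an index below [k] in [g], hence lies on the shared
     path. *)
  have newE i j : h i = g j -> exists a, h i = h (incl a).
    move=> hgij; case: (ltnP j k) => jk.
      exists (Ordinal jk); have /= -> := hg (Ordinal jk); rewrite hgij;
        congr (g _).
      by apply: val_inj; rewrite /= path_inclE.
    by move/forallP: new => /(_ j)/forallP/(_ i)/implyP/(_ jk)/eqP;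
      rewrite hgij.
  have [hV hE] := contained_comp he ie.
  have [gV gE] : contained (im (h \o incl)) (im g).
    by rewrite (eq_im hg); apply: contained_comp.
  split; apply/eqP; rewrite eqEsubset subsetI ?hV ?hE ?gV ?gE !andbT.
    apply/subsetP=> x; rewrite inE => /andP[/im_VP[i ->] /im_VP[j /newE[a ->]]].
    by apply/im_VP; exists a.
  (* A common edge has both ends on the shared path; as [h] has no chords and the path is induced in
     the hexagon, it is an edge of the path. *)
  apply/subsetP=> e; rewrite inE => /andP[eh eg].
  have [x [y [ee xy xV yV]]] := sgE_edge eh.
  have [x' [y' [ee' _ xV' yV']]] := sgE_edge eg.
  have {x' y' ee' xV' yV'}[xg yg] : x \in sgV (im g) /\ y \in sgV (im g).
    by move: ee' xV' yV'; rewrite ee => /set2_inj[] [<- <-].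
  move: xV yV xg yg => /im_VP[i xi] /im_VP[i' yi].
  move=> /im_VP[j]; rewrite xi => /newE[a xa] /im_VP[j']; rewrite yi =>
    /newE[b yb].
  have hie := emb_comp he ie.
  rewrite ee xi yi xa yb; apply/im_EP => //; exists a, b; split=> //.
  by rewrite -(adj_path_incl _ _ k6); apply: (hex_chordless he);
    rewrite -xa -yb -xi -yi.
(* Conversely, a vertex of [g] with index at least [k] that lay in [h] would be on the path, against
   the injectivity of [g]. *)
apply/forallP=> i; apply/forallP=> j; apply/implyP=> ki; apply/eqP=> gihj.
have : g i \in sgV (im h) :&: sgV (im g).
  by rewrite inE {1}gihj; apply/andP; split; apply/im_VP; [exists j | exists i].
rewrite mV => /im_VP[a]; rewrite (hg a) => /gI ia.
by move: ki; rewrite ia path_inclE // leqNgt ltn_ord.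
Qed.

Lemma hex_new_neq (h g : C6 -> G) : hex_new k h g -> im g <> im h.
Proof.
move=> new eq; have : g (c6 k) \in sgV (im h) by rewrite -eq; apply/im_VP;
  exists (c6 k).
case/im_VP=> j /eqP.
move/forallP: new => /(_ (c6 k))/forallP/(_ j)/implyP.
by rewrite c6K // => /(_ (leqnn k))/negPf->.
Qed.

Variable M : subgraph C6.
Hypothesis hM : isomorphic M (path_graph k).

(** Normal form for the pairs in the coherence conditions: after a symmetry of the hexagon, [M0] is
    the image of the first [k] vertices. *)
Lemma hex_frameM (H0 M0 : subgraph G) :
  copy_of C6 H0 -> copy_of M M0 -> contained M0 H0 ->
  exists h : {ffun C6 -> G}, [/\ emb h, H0 = im h & M0 = im (h \o incl)].
Proof.
move=> /copyP[h0 h0e ->] /(copyPiso (isomorphic_sym hM))[m me ->] mh.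
have [j je jE] := contained_factor me h0e mh.
have [s si sE] := C6_arc_extend k13 je.
exists [ffun x => h0 (s x)]; split.
- by apply: eq_emb (emb_comp h0e (iso_emb si)) => x; rewrite ffunE.
- by rewrite -(im_comp_iso h0e si); apply: eq_im => x; rewrite ffunE.
- by apply: eq_im => a; rewrite /= ffunE sE; apply: jE.
Qed.

Lemma subpath_induced : induced M.
Proof.
have [j je ->] : exists2 j : path_graph k -> C6, emb j & M = im j.
  by apply: copyP; exact: hM.
have [s [_ sA] sE] := C6_arc_extend k13 je.
move=> _ _ /im_VP[a ->] /im_VP[b ->]; rewrite -!sE sA adj_path_incl // !sE.
by rewrite im_E2.
Qed.

Lemma subpath_HM_UH : HM_UH M G.
Proof.
split; first exact: subpath_induced.
- apply: (homogeneous_UH (isomorphic_sym hM)).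
  by apply: homogeneous_sub hex_hom => m; apply: path_ext.
- by apply: (@homogeneous_UH C6) => //; exists id; split=> //; exists id.
move=> H0 M0 [cH0 _] cM0 M0H0.
have [h [he -> ->]] := hex_frameM cH0 cM0 M0H0.
have /cards1P[g gE] : #|[set g in hex_ext k h | hex_new k h g]| == 1.
  by rewrite card_hex_new.
have /setIdP[gh new] : g \in [set g in hex_ext k h | hex_new k h g].
  by rewrite gE set11.
have [ge _] := hex_extP h g k6 gh.
exists (im g); split.
  split; first exact: hex_new_neq new.
    exact: hex_induced.
  exact/hex_meetP.
(* Uniqueness: a competitor, relabelled by [hex_frame], lies in the same one-element set as [g]. *)
move=> _ [_ [/copyP[g1 g1e ->] _] meet].
have [|g2 g2h g2E] := hex_frame he g1e.
  by case: meet => mV mE; split; rewrite -?mV -?mE subsetIr.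
rewrite -g2E in meet *; have new2 := introT (hex_meetP he g2h) meet.
suff -> : g2 = g by [].
by apply/set1P; rewrite -gE inE g2h.
Qed.

Lemma subpath_coherent : coherent_UH (2 ^ (4 - k) - 1) M G.
Proof.
split; first exact: subpath_HM_UH.
move=> H0 M0 [cH0 _] cM0 M0H0.
have [h [he -> ->]] := hex_frameM cH0 cM0 M0H0.
have hh : h \in hex_ext k h by apply/hex_extP.
(* The copies through the path are the images of [hex_ext k h]; removing [im h] leaves
   [2 ^ (4 - k) - 1] of them. *)
exists ([set im g | g : {ffun C6 -> G} in hex_ext k h] :\ im h).
have imhP : im h \in [set im g | g : {ffun C6 -> G} in hex_ext k h].
  exact: imset_f.
split.
- rewrite -(card_hex_ext k13 he) -(card_in_imset (@hex_ext_inj h)).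
  by rewrite (cardsD1 (im h)) imhP add1n subn1.
- move=> K; rewrite in_setD1; split=> [/andP[/eqP Kh /imsetP[g gh KE]]|].
    have [ge hg] := hex_extP h g k6 gh.
    rewrite KE in Kh *; split=> //; first exact: hex_induced.
    have [hV hE] := contained_comp he (path_incl_emb k6).
    have [gV gE] : contained (im (h \o incl)) (im g).
      by rewrite (eq_im hg); apply: contained_comp (path_incl_emb k6).
    by split; rewrite subsetI ?hV ?hE ?gV ?gE.
  case=> /eqP-> [/copyP[g1 g1e ->] _] [].
  rewrite subsetI => /andP[gV _]; rewrite subsetI => /andP[gE _].
  have [|g gh <-] := hex_frame he g1e; first by split.
  exact: imset_f.
have /cards1P[g gE] : #|[set g in hex_ext k h | hex_new k h g]| == 1.
  by rewrite card_hex_new.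
have /setIdP[gh new] : g \in [set g in hex_ext k h | hex_new k h g].
  by rewrite gE set11.
exists (im g).
  by rewrite in_setD1; apply/andP; split;
    [apply/eqP/hex_new_neq | apply: imset_f].
by have /(hex_meetP he gh)[mV mE] := new; split; rewrite setIC.
Qed.
End Coherence.

Theorem hex_strongly_coherent (M : subgraph C6) :
  isomorphic M (path_graph 3) -> strongly_coherent_UH M G.
Proof.
move=> hM; split; first by rewrite card_ord.
have [j je ME] : exists2 j : path_graph 3 -> C6, emb j & M = im j.
  by apply: copyP; exact: hM.
have /embP[jI jA] := je.
pose i2 (a : path_graph 2) : path_graph 3 := inord a.
have i2E a : i2 a = a :> nat by rewrite inordK // (leq_trans (ltn_ord a)).
have i2e : emb i2.
  apply/embP; split=> [a b ab|a b]; last by rewrite !adj_path !i2E.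
  by apply: val_inj; rewrite /= -i2E ab i2E.
have je2 := emb_comp je i2e.
have hM2 : isomorphic (im (j \o i2)) (path_graph 2) by apply: copy_im.
have path_connected k : connected (path_graph k.+1).
  split; first by rewrite card_ord.
  have c0 (a : path_graph k.+1) : connect (@adj (path_graph k.+1)) ord0 a.
    case: a; elim=> [|n IH] ltn; first by rewrite (_ : Ordinal _ = ord0) //;
      apply: val_inj.
    apply: connect_trans (IH (ltnW ltn)) (connect1 _).
    by rewrite adj_path eqxx.
  move=> a b; apply: connect_trans (c0 b).
  by rewrite (sym_connect_sym (@adjC (path_graph k.+1))).
(* The sequence is [M] followed by the edge on its first two vertices, which also serves as the
   default value at irrelevant indices. *)
exists 2, (fun i => if i == 1 then M else im (j \o i2)); split=> //=.
- apply: isomorphic_trans hM2 _; exists id; split; first by exists id.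
  move=> a b; rewrite adj_path /= /simple_rel -val_eqE /=.
  have := ltn_ord a; have := ltn_ord b; lia.
- case=> [|[|[|i]]] //= _; apply: connected_iso (path_connected _).
    exact: isomorphic_sym hM.
  exact: isomorphic_sym hM2.
- case=> [|[|i]] //= _; rewrite ME.
  (* The deleted vertex is [j e], an end of the path. *)
  pose e : path_graph 3 := ord_max.
  have i2n a : i2 a != e.
    by rewrite -val_eqE /= i2E neq_ltn ltn_ord.
  have lift2 a : a != e -> exists b, a = i2 b.
    move=> ae; have lta : a < 2 by have := ltn_ord a; move: ae;
      rewrite -val_eqE /=; lia.
    by exists (Ordinal lta); apply: val_inj; rewrite /= i2E.
  exists (j e); first by apply/im_VP; exists e.
  split; apply/setP=> x.
    rewrite in_setD1; apply/im_VP/andP=> [[a ->]|[xe /im_VP[a xa]]].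
      by split; [apply/eqP=> /jI/eqP; apply/negP/i2n | apply/im_VP; exists
        (i2 a)].
    have [|b ab] := lift2 a; first by apply: contraNneq xe => <-; rewrite xa.
    by exists b; rewrite xa ab.
  rewrite inE; apply/im_EP/andP=> // [[a [b [ab ->]]]|[/im_EP[] // a [b [ab
    ->]]]].
    rewrite ![(j \o i2) _]/= im_E2 // !inE !(inj_eq jI) ![e == _]eq_sym !(negPf
      (i2n _)).
    by split=> //; case/embP: i2e => _; apply.
  rewrite !inE !(inj_eq jI) negb_or ![e == _]eq_sym => /andP[].
  move=> /lift2[a' aE] /lift2[b' bE]; exists a', b';
    rewrite ![(j \o i2) _]/= -aE -bE.
  by split=> //; move: ab; rewrite aE bE !adj_path !i2E.
(* Since [i = 4 - k], index 1 uses [k = 3] and index 2 uses [k = 2]. *)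
- case=> [|[|[|i]]] //= _.
    exact: (@subpath_coherent 3).
  exact: (@subpath_coherent 2).
Qed.
End Hexagons.

(** * Enumeration of hexagons *)

Section Enumeration.
Variables (G : sgraph) (x0 : G) (vs : seq G) (N : G -> seq G).
Hypothesis mem_vs : forall x, x \in vs.
Hypothesis adjN : forall x y : G, adj x y = (y \in N x).

(** Here [k] counts edges, so the words have [k + 1] letters; repeated vertices are allowed and
    filtered out later. *)
Fixpoint walks (k : nat) (x : G) : seq (seq G) :=
  if k is k'.+1 then [seq x :: s | s <- flatten [seq walks k' y | y <- N x]]
  else [:: [:: x]].

Definition all_walks k := flatten [seq walks k x | x <- vs].

Definition hexword (s : seq G) : bool :=
  [&& size s == 6, uniq s & cycle (fun x y => y \in N x) s].

Definition hexwords : seq (seq G) := [seq s <- all_walks 5 | hexword s].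

Lemma mem_walks x s : path (@adj G) x s -> x :: s \in walks (size s) x.
Proof.
elim: s x => [|y s IH] x /=; first by rewrite inE.
case/andP; rewrite adjN => xy /IH ys; apply: map_f.
by apply/flatten_mapP; exists y.
Qed.

Lemma mem_all_walks x s : path (@adj G) x s -> x :: s \in all_walks (size s).
Proof. by move=> xs; apply/flatten_mapP; exists x; last exact: mem_walks. Qed.

Lemma mem_hexwords s : (s \in hexwords) = hexword s.
Proof.
rewrite mem_filter; apply/andb_idr; case/and3P; case: s => // x s /eqP[s5] _
  /= cs.
rewrite -s5; apply: mem_all_walks; move: cs; rewrite rcons_path => /andP[+ _].
by rewrite (eq_path adjN).
Qed.

Definition word (h : C6 -> G) : seq G := mkseq (fun i => h (c6 i)) 6.
Definition unword (s : seq G) : {ffun C6 -> G} := [ffun i : C6 => nth x0 s i].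

Lemma nth_word h (i : C6) : nth x0 (word h) i = h i.
Proof. by rewrite nth_mkseq ?ltn_ord // c6_val. Qed.

Lemma unwordK s : size s = 6 -> word (unword s) = s.
Proof.
move=> s6; apply: (@eq_from_nth _ x0); rewrite size_mkseq // => i i6.
by rewrite nth_mkseq // ffunE c6K.
Qed.

Lemma word_inj : injective (fun g : {ffun C6 -> G} => word g).
Proof. by move=> f g fg; apply/ffunP=> i; rewrite -!nth_word fg. Qed.

Lemma emb_hexword h : emb h -> hexword (word h).
Proof.
move=> /embP[hI hA]; apply/and3P; split; first by rewrite size_mkseq.
  apply/mkseq_uniqP => i j i6 j6 /hI/(congr1 val).
  by rewrite /= !c6K.
by rewrite /= -!adjN !hA // adj_C6 !c6K.
Qed.

Lemma hexword_emb s : hexword s -> emb (unword s).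
Proof.
case/and3P=> /eqP s6 us cs; apply/embP; split=> [i j|i j].
  rewrite !ffunE => /eqP; rewrite nth_uniq ?s6 ?ltn_ord // => /eqP.
  exact: val_inj.
have {}cs : cycle (@adj G) s.
  by case: s cs {s6 us} => //= x s; rewrite (eq_path adjN).
have next (a b : C6) : b == a.+1 %% 6 :> nat -> adj (nth x0 s a) (nth x0 s b).
  case: s s6 cs {us} => [|v0 [|v1 [|v2 [|v3 [|v4 [|v5 [|//]]]]]]] // _.
  case/and5P=> ? ? ? ? /and3P[? ? _].
  by case: a => -[|[|[|[|[|[|//]]]]]] ? /= /eqP->.
rewrite adj_C6 !ffunE /cyc6 => /andP[_ /orP[]]; first exact: next.
by rewrite adjC; apply: next.
Qed.

Lemma forall_C6 (P : nat -> bool) : [forall i : C6, P i] = all P (iota 0 6).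
Proof.
apply/forallP/idP => [hP|/all_ordP//].
apply/allP=> i; rewrite mem_iota => /andP[_ i6]; exact: (hP (Ordinal i6)).
Qed.

Definition ext_word k (s t : seq G) : bool :=
  all (fun i => (i < k) ==> (nth x0 t i == nth x0 s i)) (iota 0 6).
Definition new_word k (s t : seq G) : bool :=
  all (fun i => all (fun j => (k <= i) ==> (nth x0 t i != nth x0 s j))
    (iota 0 6)) (iota 0 6).

Lemma ext_wordE k h g :
  [forall i : C6, (i < k) ==> (g i == h i)] = ext_word k (word h) (word g).
Proof.
by rewrite /ext_word -forall_C6; apply: eq_forallb => i; rewrite !nth_word.
Qed.

Lemma new_wordE k h g : hex_new k h g = new_word k (word h) (word g).
Proof.
rewrite /new_word -forall_C6; apply: eq_forallb => i.
by rewrite -forall_C6; apply: eq_forallb => j; rewrite !nth_word.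
Qed.

(** Embeddings correspond bijectively to the words in [hexwords], so cardinalities reduce to
    counting in a list. *)
Lemma card_emb_word (P : pred (seq G)) : uniq hexwords ->
  #|[set g : {ffun C6 -> G} | emb g & P (word g)]| = count P hexwords.
Proof.
move=> uL; rewrite cardE -(size_map (fun g : {ffun C6 -> G} =>
  word g)) -size_filter.
apply/perm_size/uniq_perm; first by rewrite (map_inj_uniq word_inj) enum_uniq.
  exact: filter_uniq.
move=> s; rewrite mem_filter mem_hexwords; apply/mapP/andP=> [[g]|[Ps sL]].
  by rewrite mem_enum inE => /andP[/emb_hexword ge Pg] ->.
have ws : word (unword s) = s by apply: unwordK; case/and3P: sL => /eqP.
by exists (unword s); rewrite ?ws // mem_enum inE hexword_emb ?ws.
Qed.

(** A vertex map is stored as the table of its values along [vs]. *)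
Definition act (t : seq G) (x : G) : G := nth x0 t (index x vs).

Definition aut_table (t : seq G) : bool :=
  all (fun x => all (fun y => ((act t x == act t y) == (x == y)) &&
    ((act t y \in N (act t x)) == (y \in N x))) vs) vs.

Lemma aut_table_iso t : aut_table t -> is_iso (act t).
Proof.
move=> /allP tP; have {}tP x y := allP (tP x (mem_vs x)) y (mem_vs y).
split=> [|x y]; last by rewrite !adjN; case/andP: (tP x y) => _ /eqP.
by apply: injF_bij => x y /eqP; case/andP: (tP x y) => /eqP-> _ /eqP.
Qed.

Definition orbit_step (ts : seq (seq G)) (S : seq (seq G)) : seq (seq G) :=
  S ++ undup [seq s <- [seq map (act t) s | t <- ts, s <- S] | s \notin S].

(** Soundness of the orbit search: each word reached comes from [base] by a composite of the given
    automorphisms. That the search reaches every hexagon is tested by computation. *)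
Lemma orbit_iso ts base n s : all aut_table ts ->
  s \in iter n (orbit_step ts) [:: base] ->
  exists2 phi : G -> G, is_iso phi & s = map phi base.
Proof.
move=> /allP tsP; elim: n s => [|n IH] s /=.
  by rewrite inE => /eqP->; exists id; [split=> //; exists id | rewrite map_id].
rewrite mem_cat mem_undup mem_filter => /orP[/IH//|/andP[_]].
case/allpairsP=> -[t u] /= [/tsP/aut_table_iso ti /IH[phi phii ->] ->].
by exists (act t \o phi); [exact: iso_comp | rewrite map_comp].
Qed.

Lemma hex_orbit_homogeneous ts base n : all aut_table ts ->
  {subset hexwords <= iter n (orbit_step ts) [:: base]} -> homogeneous C6 G.
Proof.
move=> tsP sub f g.
have orb h : emb h -> exists2 phi : G -> G, is_iso phi & word h = map phi base.
  by move=> he; apply: (orbit_iso tsP (sub _ _));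
    rewrite mem_hexwords emb_hexword.
move=> /orb[phi phii fE] /orb[psi psii gE].
have [phi' phii' [phiK _]] := iso_sym phii.
have sz : size base = 6 by rewrite -(size_map phi) -fE size_mkseq.
(* Go back from [f] to [base], then forward to [g]. *)
exists (psi \o phi'); first exact: iso_comp.
by move=> i; rewrite -!nth_word fE gE !(nth_map x0) ?sz ?ltn_ord //= phiK.
Qed.

(** A path on [k] vertices has [k - 1] edges, whence [k.-1]. Binding [L'] outside the test lets the
    prefixes be computed once. *)
Definition paths_extend (L : seq (seq G)) k : bool :=
  let L' := map (take k) L in
  all (fun s => uniq s ==> (s \in L')) (all_walks k.-1).

Lemma paths_extendP k (m : path_graph k -> G) : 0 < k < 6 -> paths_extend
  hexwords k ->
  emb m -> exists2 h : C6 -> G, emb h & m =1 h \o @path_incl k.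
Proof.
case: k m => // k m /andP[_ k6] /allP kP /embP[mI mA].
pose w := mkseq (fun i => m (inord i)) k.+1.
have /mapP[s sL ws] : w \in map (take k.+1) hexwords.
  have /kP/implyP : w \in all_walks k; last apply.
    have -> : k = size (map (fun i => m (inord i)) (iota 1 k)).
      by rewrite size_map size_iota.
    rewrite -/(mkseq _ _); apply: mem_all_walks.
    apply/(pathP x0) => i; rewrite size_map size_iota => ik.
    change (adj (nth x0 w i) (nth x0 w i.+1)).
    have ik1 : i < k.+1 by exact: ltnW.
    by rewrite !nth_mkseq //; apply: mA; rewrite adj_path !inordK ?eqxx.
  apply/mkseq_uniqP => i j ik jk /mI/(congr1 val).
  by rewrite /= !inordK.
exists (unword s); first by apply: hexword_emb; rewrite -mem_hexwords.
move=> a; rewrite /= ffunE path_inclE // -(nth_take _ (ltn_ord a)) -ws.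
by rewrite nth_mkseq ?inord_val // ltn_ord.
Qed.

(* [L] is a parameter so that [hexwords] is evaluated only once. *)
Definition hex_check_on (ts : seq (seq G)) n (L : seq (seq G)) : bool :=
  [&& uniq L, all aut_table ts,
    (let orb := iter n (orbit_step ts) [:: head [::] L] in
     all (fun s => s \in orb) L),
    paths_extend L 2, paths_extend L 3,
    all (fun s => all (fun i => all (fun j =>
      (nth x0 s j \in N (nth x0 s i)) ==> cyc6 i j)
        (iota 0 6)) (iota 0 6)) L &
    all (fun s => all (fun k => let L' := filter (ext_word k s) L in
      (size L' == 2 ^ (4 - k)) && (count (new_word k s) L' == 1)) [:: 2; 3])
      L].

Definition hex_check ts n : bool := hex_check_on ts n hexwords.

Theorem hex_check_strongly_coherent ts n (M : subgraph C6) :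
  hex_check ts n -> isomorphic M (path_graph 3) -> strongly_coherent_UH M G.
Proof.
case/and5P=> uL tsP /allP orb ext2 /and3P[ext3 /allP chord /allP cnt].
have mem_word (h : C6 -> G) : emb h -> word h \in hexwords.
  by move=> /emb_hexword; rewrite mem_hexwords.
have k23 k : 1 < k <= 3 -> k \in [:: 2; 3] by case: k => [|[|[|[|]]]].
apply: hex_strongly_coherent.
- exact: hex_orbit_homogeneous tsP orb.
- move=> k m k13; apply: paths_extendP; first by lia.
  by move: (k23 k k13); rewrite !inE => /orP[] /eqP->.
- move=> h /mem_word/chord/all2_ordP hP x y; rewrite adjN -!nth_word.
  exact/implyP/hP.
- move=> k h /k23 k13 /mem_word/cnt/allP/(_ k k13)/andP[/eqP <- _].
  rewrite size_filter -card_emb_word //; apply: eq_card => g.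
  by rewrite !inE ext_wordE.
- move=> k h /k23 k13 /mem_word/cnt/allP/(_ k k13)/andP[_ /eqP cE].
  rewrite -[RHS]cE count_filter -card_emb_word //; apply: eq_card => g.
  by rewrite !inE ext_wordE new_wordE -andbA [X in _ && X]andbC.
Qed.
End Enumeration.

(** * The two graphs *)

(** Replaces a quantifier over a finite type by a search along an explicit list, which [vm_compute]
    can evaluate. *)
Lemma existsb_has (T : finType) (s : seq T) (P : pred T) :
  (forall x, x \in s) -> [exists x, P x] = has P s.
Proof.
by move=> sT; apply/existsP/hasP=> [[x Px]|[x _ Px]]; exists x.
Qed.

Lemma eq_rel_all (T : eqType) (s : seq T) (r r' : rel T) :
  (forall x, x \in s) -> all (fun x => all (fun y => r x y == r' x y) s) s ->
  r =2 r'.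
Proof. by move=> sT /allP rr x y; apply/eqP/(allP (rr x (sT x)))/sT. Qed.

(* Unlike [enum], this list reduces under [vm_compute]. *)
Definition ords n : seq 'I_n.+1 := [seq inZp i | i <- iota 0 n.+1].

Lemma mem_ords n (x : 'I_n.+1) : x \in ords n.
Proof.
by apply/mapP; exists (val x); rewrite ?valZpK // mem_iota ltn_ord.
Qed.

(* Neighbours in LCF notation: the chord at [u] has length [o_(u mod |o|)]. *)
Definition lcf n (o : seq nat) (u : 'Z_n) : seq 'Z_n :=
  [:: u + 1; u - 1; u + (nth 0 o (u %% size o))%N%:R]%R.

(** In signed form the codes are [-5, 5, 7, -7, 7, -7]^3 and [-5, 9, -9, 5]^5; negative lengths are
    reduced modulo 18 and 20. *)
Definition Pappus_nbr : 'Z_18 -> seq 'Z_18 := lcf [:: 13; 5; 7; 11; 7; 11].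
Definition Desargues_nbr : 'Z_20 -> seq 'Z_20 := lcf [:: 15; 9; 11; 5].

Lemma Pappus_adj (u v : Pappus) : adj u v = (v \in Pappus_nbr u).
Proof.
rewrite /= /simple_rel /Pappus_arc !(existsb_has _ (@mem_ords 2)).
move: u v; refine (eq_rel_all (r := fun u v => _) (r' := fun u v => _)
  (@mem_ords 17) _).
by vm_compute.
Qed.

Lemma Desargues_adj (u v : Desargues) : adj u v = (v \in Desargues_nbr u).
Proof.
rewrite /= /simple_rel /Desargues_arc !(existsb_has _ (@mem_ords 4)).
move: u v; refine (eq_rel_all (r := fun u v => _) (r' := fun u v => _)
  (@mem_ords 19) _).
by vm_compute.
Qed.

(** The first fixes 0 and permutes its neighbours 1, 17, 13 cyclically; the second shifts the arc
    (0, 1) to (1, 2). *)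
Definition Pappus_auts : seq (seq 'Z_18) := map (map inZp)
  [:: [:: 0; 17; 10; 9; 8; 15; 16; 5; 4; 11; 12; 7; 6; 1; 2; 3; 14; 13];
      [:: 1; 2; 9; 10; 11; 4; 3; 14; 15; 8; 7; 12; 13; 0; 17; 16; 5; 6]].

(** The first fixes 0 and permutes its neighbours 1, 19, 15 cyclically; the second exchanges the
    even and the odd vertices. *)
Definition Desargues_auts : seq (seq 'Z_20) := map (map inZp)
  [:: [:: 0; 19; 18; 17; 16; 11; 12; 7; 6; 5; 4; 3; 8; 9; 10; 1; 2; 13; 14; 15];
      [:: 3; 2; 13; 12; 7; 6; 17; 16; 11; 10; 1; 0; 15; 14; 5; 4; 19; 18; 9;
        8]].

(** Ten rounds of the orbit search reach every labelled hexagon, here and for the Desargues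
    graph. *)
Lemma Pappus_check :
  @hex_check Pappus ord0 (ords 17) Pappus_nbr Pappus_auts 10.
Proof. by vm_compute. Qed.

Lemma Desargues_check :
  @hex_check Desargues ord0 (ords 19) Desargues_nbr Desargues_auts 10.
Proof. by vm_compute. Qed.

Theorem theorem1 (G : sgraph) (hG : G = Pappus \/ G = Desargues)
  (M : subgraph (cycle_graph 6)) (hM : isomorphic M (path_graph 3)) :
  strongly_coherent_UH M G.
Proof.
case: hG => ->.
- exact: (hex_check_strongly_coherent (G := Pappus)
    (@mem_ords 17) Pappus_adj Pappus_check hM).
- exact: (hex_check_strongly_coherent (G := Desargues)
    (@mem_ords 19) Desargues_adj Desargues_check hM).
Qed.
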